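(* For every natural number $n \ge 4$ and every integer $i$ with $n - 2\lfloor n/3 \rfloor \le i \le n$, the number $|C_n^i|$ is the coefficient of $x^n y^i$ in the (formal power) series expansion of $$f(x,y) = \frac{x^4y^2\,(4+y^2+xy+3x^2+x^2y^2)}{1-xy-x^3y}.$$
   Context: A set $S \subseteq V$ of vertices of a graph $G=(V,E)$ is a restrained dominating set (RDS) if every vertex not in $S$ is adjacent to a vertex in $S$ and also adjacent to a vertex in $V - S$. $C_n$ denotes the cycle with vertex set $\{1,2,\dots,n\}$ in which consecutive integers are adjacent and $n$ is adjacent to $1$. $C_n^i$ denotes the set of all restrained dominating sets of $C_n$ of cardinality $i$. *)

(* Defs.v *)
From HB Require Import structures.
From mathcomp Require Import all_boot all_order all_algebra.
From mathcomp Require Import boolp.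

Set Implicit Arguments.
Unset Strict Implicit.
Unset Printing Implicit Defensive.

Import GRing.Theory.
Local Open Scope ring_scope.

(* Bivariate series are obtained by iterating this ring: R[[x, y]] = R[[y]][[x]]. *)
Record fps (R : Type) : Type := Fps { fcoef : nat -> R }.

Lemma fpsP (R : Type) (f g : fps R) :
  (forall n, fcoef f n = fcoef g n) -> f = g.
Proof.
by case: f g => [u] [v] /= uv; congr Fps; apply: funext.
Qed.

HB.instance Definition _ (R : Type) := gen_eqMixin (fps R).
HB.instance Definition _ (R : Type) := gen_choiceMixin (fps R).

Definition fps0 (R : zmodType) : fps R := Fps (fun=> 0).
Definition fps_opp (R : zmodType) (f : fps R) : fps R :=
  Fps (fun n => - fcoef f n).
Definition fps_add (R : zmodType) (f g : fps R) : fps R :=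
  Fps (fun n => fcoef f n + fcoef g n).

Lemma fps_addA (R : zmodType) : associative (@fps_add R).
Proof. by move=> f g h; apply: fpsP => n /=; rewrite addrA. Qed.
Lemma fps_addC (R : zmodType) : commutative (@fps_add R).
Proof. by move=> f g; apply: fpsP => n /=; rewrite addrC. Qed.
Lemma fps_add0 (R : zmodType) : left_id (@fps0 R) (@fps_add R).
Proof. by move=> f; apply: fpsP => n /=; rewrite add0r. Qed.
Lemma fps_addN (R : zmodType) : left_inverse (@fps0 R) (@fps_opp R) (@fps_add R).
Proof. by move=> f; apply: fpsP => n /=; rewrite addNr. Qed.

HB.instance Definition _ (R : zmodType) :=
  GRing.isZmodule.Build (fps R)
    (@fps_addA R) (@fps_addC R) (@fps_add0 R) (@fps_addN R).

Definition fpsC (R : zmodType) (c : R) : fps R :=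
  Fps (fun n => if n == 0%N then c else 0).
Definition fps_mul (R : comNzRingType) (f g : fps R) : fps R :=
  Fps (fun n => \sum_(j < n.+1) fcoef f j * fcoef g (n - j)%N).

Definition fps_trunc (R : comNzRingType) (N : nat) (f : fps R) : {poly R} :=
  \poly_(i < N) fcoef f i.

Lemma coef_fps_trunc (R : comNzRingType) (N : nat) (f : fps R) (n : nat) :
  (n < N)%N -> (fps_trunc N f)`_n = fcoef f n.
Proof. by move=> nN; rewrite coef_poly nN. Qed.

Lemma fps_mul_trunc (R : comNzRingType) (N : nat) (f g : fps R) (n : nat) :
  (n < N)%N -> fcoef (fps_mul f g) n = (fps_trunc N f * fps_trunc N g)`_n.
Proof.
move=> nN; rewrite coefM /=; apply: eq_bigr => j _.
rewrite !coef_fps_trunc //; first exact: leq_ltn_trans (leq_subr _ _) nN.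
exact: leq_trans (ltn_ord j) nN.
Qed.

Lemma fps_mulC (R : comNzRingType) : commutative (@fps_mul R).
Proof.
by move=> f g; apply: fpsP => n; rewrite !(@fps_mul_trunc _ n.+1) // mulrC.
Qed.

Lemma fps_mulA (R : comNzRingType) : associative (@fps_mul R).
Proof.
have aux (f g h : fps R) n : fcoef (fps_mul f (fps_mul g h)) n =
    (fps_trunc n.+1 f * (fps_trunc n.+1 g * fps_trunc n.+1 h))`_n.
  rewrite coefM; apply: eq_bigr => j _.
  by rewrite coef_fps_trunc // -fps_mul_trunc // ltnS leq_subr.
move=> f g h; apply: fpsP => n; rewrite (fps_mulC (fps_mul f g)) !aux.
by rewrite mulrA (mulrC (fps_trunc _ h)).
Qed.

Lemma fps_mul1 (R : comNzRingType) : left_id (fpsC 1) (@fps_mul R).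
Proof.
move=> f; apply: fpsP => n /=; rewrite big_ord_recl /= mul1r subn0.
by rewrite big1 ?addr0 // => j _; rewrite mul0r.
Qed.

Lemma fps_mulDl (R : comNzRingType) :
  left_distributive (@fps_mul R) (@fps_add R).
Proof.
move=> f g h; apply: fpsP => n /=; rewrite -big_split /=.
by apply: eq_bigr => j _; rewrite mulrDl.
Qed.

Lemma fps1_neq0 (R : comNzRingType) : fpsC (1 : R) != 0.
Proof.
by apply/eqP => /(congr1 (fun f => fcoef f 0))/eqP; rewrite /= oner_eq0.
Qed.

HB.instance Definition _ (R : comNzRingType) :=
  GRing.Zmodule_isComNzRing.Build (fps R)
    (@fps_mulA R) (@fps_mulC R) (@fps_mul1 R) (@fps_mulDl R) (@fps1_neq0 R).

Definition fpsX (R : comNzRingType) : fps R := Fps (fun n => (n == 1%N)%:R).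

Lemma fcoefD (R : zmodType) (f g : fps R) n :
  fcoef (f + g) n = fcoef f n + fcoef g n.
Proof. by []. Qed.

Lemma fcoefB (R : zmodType) (f g : fps R) n :
  fcoef (f - g) n = fcoef f n - fcoef g n.
Proof. by []. Qed.

Lemma fcoefM (R : comNzRingType) (f g : fps R) n :
  fcoef (f * g) n = \sum_(j < n.+1) fcoef f j * fcoef g (n - j)%N.
Proof. by []. Qed.

Lemma fcoef_sum (R : zmodType) (I : Type) (r : seq I) (P : pred I)
    (F : I -> fps R) n :
  fcoef (\sum_(i <- r | P i) F i) n = \sum_(i <- r | P i) fcoef (F i) n.
Proof. by elim/big_rec2: _ => //= i c g _ <-. Qed.

Lemma fcoefX_lt (R : comNzRingType) (u : fps R) k n :
  fcoef u 0 = 0 -> (n < k)%N -> fcoef (u ^+ k) n = 0.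
Proof.
move=> u0; elim: k n => // k IHk n nk; rewrite exprS fcoefM big_ord_recl u0.
rewrite mul0r add0r big1 // => j _; rewrite IHk ?mulr0 //.
by case: n nk j => [|n] nk j; [case: j | rewrite lift0 subSS (leq_ltn_trans (leq_subr _ _))].
Qed.

Definition fps_unit (R : comUnitRingType) : {pred fps R} :=
  fun f => fcoef f 0 \is a GRing.unit.

(* 1 / f = c * sum_k (1 - c * f)^k with c = 1 / f(0); the k-th power does *)
(* not contribute to the coefficients of index < k.                       *)
Definition fps_inv (R : comUnitRingType) (f : fps R) : fps R :=
  if fps_unit f then
    let c := fpsC (fcoef f 0)^-1 in
    Fps (fun n => fcoef (c * \sum_(k < n.+1) (1 - c * f) ^+ k) n)
  else f.

Lemma fps_mulVx (R : comUnitRingType) :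
  {in @fps_unit R, left_inverse 1 (@fps_inv R) *%R}.
Proof.
move=> f fU; rewrite /fps_inv; have fU' : fps_unit f by [].
rewrite fU'; set c := fpsC _; set u := 1 - c * f.
have u0 : fcoef u 0 = 0.
  by rewrite fcoefB fcoefM big_ord1 /= mulVr ?subrr.
have cf : c * f = 1 - u by rewrite /u opprB addrC subrK.
apply: fpsP => n; rewrite fcoefM.
have coefS m : (m <= n)%N -> fcoef (c * \sum_(k < m.+1) u ^+ k) m =
    fcoef (c * \sum_(k < n.+1) u ^+ k) m.
  move=> mn; rewrite -!(big_mkord xpredT (fun k => u ^+ k)).
  rewrite [in RHS](big_cat_nat (n := m.+1)) // mulrDr.
  set A := c * _; set B := c * _; suff B0 : fcoef B m = 0.
    by rewrite -[LHS]addr0 -B0.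
  rewrite /B fcoefM [LHS]big1 // => j _; rewrite fcoef_sum big1_seq ?mulr0 // => k.
  rewrite mem_index_iota => /and3P[_ mk _]; apply: fcoefX_lt => //.
  exact: leq_ltn_trans (leq_subr _ _) mk.
have -> : 1 = c * (\sum_(k < n.+1) u ^+ k) * f + u ^+ n.+1.
  by rewrite mulrAC cf -[1 - u]opprB mulNr -subrX1 opprB subrK.
transitivity (fcoef ((c * \sum_(k < n.+1) u ^+ k) * f) n); last first.
  by rewrite fcoefD (@fcoefX_lt _ _ n.+1) // addr0.
rewrite [RHS]fcoefM; apply: eq_bigr => j _.
by congr (_ * _); apply: coefS; rewrite -ltnS.
Qed.

Lemma fps_unitPl (R : comUnitRingType) (f g : fps R) :
  g * f = 1 -> fps_unit f.
Proof.
move=> /(congr1 (fun h => fcoef h 0)); rewrite fcoefM big_ord1 /= => gf.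
by apply/unitrPr; exists (fcoef g 0); rewrite mulrC.
Qed.

Lemma fps_inv_out (R : comUnitRingType) :
  {in [predC @fps_unit R], @fps_inv R =1 id}.
Proof. by move=> f /negP fN; rewrite /fps_inv; case: ifP. Qed.

HB.instance Definition _ (R : comUnitRingType) :=
  GRing.ComNzRing_hasMulInverse.Build (fps R)
    (@fps_mulVx R) (@fps_unitPl R) (@fps_inv_out R).

Lemma fps_unitE (R : comUnitRingType) (f : fps R) :
  (f \is a GRing.unit) = (fcoef f 0 \is a GRing.unit).
Proof. by []. Qed.

(* The coefficient of x^n y^i in a series of R[[y]][[x]]. *)
Definition coefxy (R : Type) (f : fps (fps R)) (n i : nat) : R :=
  fcoef (fcoef f n) i.

Definition restrained_dominating (T : finType) (e : rel T) (S : {set T}) : bool :=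
  [forall v, (v \notin S) ==>
    [exists u, (u \in S) && e v u] && [exists w, (w \notin S) && e v w]].

(* The cycle C_n for n >= 3, with vertices 1, ..., n shifted to 0, ..., n - 1. *)
Definition cycle_adj (n : nat) : rel 'I_n := fun u v =>
  [|| u.+1 == v :> nat, v.+1 == u :> nat,
      (u == n.-1 :> nat) && (v == 0 :> nat)
    | (v == n.-1 :> nat) && (u == 0 :> nat)].

Definition cycle_RDS (n i : nat) : {set {set 'I_n}} :=
  [set S : {set 'I_n} | restrained_dominating (@cycle_adj n) S & #|S| == i].

(* Main.v *)
(* A set is restrained dominating in C_n exactly when each vertex outside it has
   one neighbour inside and one outside, a condition on three consecutive
   vertices.  Hence the generating polynomials sum_S y^|S| are traces of powers
   of a 4 x 4 transfer matrix on pairs of consecutive letters and satisfy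
   W_n = y W_(n-1) + y W_(n-3), the recurrence imposed by the denominator
   1 - x y - x^3 y; the numerator accounts for the initial values. *)
Require Import Defs.
From mathcomp Require Import all_boot all_order all_algebra.
From mathcomp Require Import ring zify.
Import GRing.Theory.
Local Open Scope ring_scope.

(** * Coefficients of products with constants and powers of the variable *)

Section FpsCoefficients.
Variable R : comNzRingType.
Implicit Types (c d : R) (g : fps R).

Lemma fcoefCM c g n : fcoef (fpsC c * g) n = c * fcoef g n.
Proof.
rewrite fcoefM big_ord_recl /= subn0 big1 ?addr0 // => j _.
by rewrite mul0r.
Qed.

Lemma fcoefXM g n : fcoef (fpsX R * g) n.+1 = fcoef g n.
Proof.
rewrite fcoefM big_ord_recl /= mul0r add0r big_ord_recl /= mul1r subn1 /=.
by rewrite big1 ?addr0 // => j _; rewrite mul0r.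
Qed.

Lemma fcoefXnM k g n :
  fcoef (fpsX R ^+ k * g) n = if (n < k)%N then 0 else fcoef g (n - k).
Proof.
elim: k n => [|k IHk] n; first by rewrite mul1r subn0.
case: n => [|n]; last by rewrite exprS -mulrA fcoefXM IHk ltnS subSS.
by rewrite exprS -mulrA fcoefM big_ord1 /= mul0r.
Qed.

Lemma fcoefXn k n : fcoef (fpsX R ^+ k) n = (k == n)%:R.
Proof.
rewrite -[_ ^+ k]mulr1 fcoefXnM /=; case: (ltngtP n k) => [//|kn|->].
  by rewrite subn_eq0 leqNgt kn.
by rewrite subnn.
Qed.

Lemma fpsCD c d : fpsC (c + d) = fpsC c + fpsC d.
Proof. by apply: fpsP => -[|n] //=; rewrite addr0. Qed.

Lemma fpsCM c d : fpsC (c * d) = fpsC c * fpsC d.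
Proof.
by apply: fpsP => n; rewrite fcoefCM /=; case: n => [|n] //=; rewrite mulr0.
Qed.

Lemma fpsC1 : fpsC (1 : R) = 1.
Proof. by []. Qed.

End FpsCoefficients.

(** * Restrained domination on the cycle as a local condition on words *)

(* A vertex outside [S] has exactly one of its two neighbours in [S]. *)
Definition locally_restrained (a b c : bool) : bool := b || (a (+) c).

Fixpoint restrained_path (a b : bool) (s : seq bool) : bool :=
  if s is c :: s' then locally_restrained a b c && restrained_path b c s'
  else true.

Lemma restrained_pathP (a b : bool) (s : seq bool) :
  let t := [:: a, b & s] in
  reflect (forall k, (k < size s)%N -> locally_restrained
             (nth false t k) (nth false t k.+1) (nth false t k.+2))
          (restrained_path a b s).
Proof.
elim: s a b => [|c s IHs] a b /=; first by left.
apply: (iffP andP) => [[abc /IHs bcs] [|k] //= ks|H]; first exact: (bcs k).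
by split; [exact: (H 0%N) | apply/IHs => k ks; exact: (H k.+1)].
Qed.

Lemma cycle_adjE (n : nat) (v u : 'I_n) : (2 < n)%N ->
  cycle_adj v u = (u == ordS v) || (u == ord_pred v).
Proof.
move=> n2; rewrite /cycle_adj -!val_eqE /=.
have [vn un] := (ltn_ord v, ltn_ord u).
have -> : (v.+1 %% n)%N = if v.+1 == n then 0%N else v.+1.
  by case: eqP => [->|?]; rewrite ?modnn // modn_small //; lia.
have -> : ((v + n).-1 %% n)%N = if v == 0%N :> nat then n.-1 else v.-1.
  case: eqP => [->|v0]; first by rewrite add0n modn_small //; lia.
  have -> : (v + n).-1 = (v.-1 + n)%N by lia.
  by rewrite modnDr modn_small //; lia.
by case: (v.+1 =P n) => ?; case: (v =P 0%N :> nat) => ?; lia.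
Qed.

(** For a vertex outside [S], one neighbour inside and one outside means that its two neighbours
    differ, whence the [(+)]. The window centred at [v] is then rotated to start at [v], so that
    windows can be read along a word. *)
Lemma restrained_dominating_cycleE (n : nat) (S : {set 'I_n}) : (2 < n)%N ->
  restrained_dominating (@cycle_adj n) S =
  [forall v : 'I_n, locally_restrained
     (v \in S) (ordS v \in S) (ordS (ordS v) \in S)].
Proof.
move=> n2.
have ex2 (P : pred 'I_n) v : [exists u, P u && cycle_adj v u] =
    P (ordS v) || P (ord_pred v).
  apply/existsP/orP => [[u]|[] Pv].
  - by rewrite cycle_adjE // => /andP[Pu /orP[]/eqP <-]; [left|right].
  - by exists (ordS v); rewrite Pv cycle_adjE // eqxx.
  - by exists (ord_pred v); rewrite Pv cycle_adjE // eqxx orbT.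
transitivity [forall v : 'I_n, locally_restrained
    (ord_pred v \in S) (v \in S) (ordS v \in S)].
  apply: eq_forallb => v; rewrite (ex2 (mem S)) (ex2 [predC S]) /=.
  by rewrite /locally_restrained; do 3!case: (_ \in S).
apply/forallP/forallP => H v.
  by have := H (ordS v); rewrite ordSK.
by have := H (ord_pred v); rewrite ord_predK.
Qed.

(** Repeating the first two letters at the end turns the windows that wrap around the cycle into
    ordinary windows of a linear word. *)
Lemma restrained_dominating_word (m : nat) (a b : bool) (w : m.-tuple bool) :
  (0 < m)%N ->
  restrained_dominating (@cycle_adj m.+2)
    [set v | tnth [tuple of [:: a, b & w]] v] =
  restrained_path a b (w ++ [:: a; b]).
Proof.
move=> m0; rewrite restrained_dominating_cycleE //.
set t := [tuple of _]; set s := [:: a, b & w ++ [:: a; b]].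
have sw : size w = m by rewrite size_tuple.
(* Only the indices [m.+2] and [m.+3] overflow, and they fall on the repeated letters [a] and
   [b]. *)
have ts (k : nat) : (k < m.+4)%N -> nth false s k = nth false t (k %% m.+2)%N.
  move=> km; rewrite /s /t /= -!cat_cons nth_cat /= sw.
  case: ltnP => [kl|kl]; first by rewrite modn_small.
  rewrite -(subnK kl) modnDr addnK modn_small ?ltn_subLR //; last lia.
  have : (k - m.+2 < 2)%N by lia.
  by move: (k - m.+2)%N => [|[|]].
have tS (v : 'I_m.+2) : (v \in [set v | tnth t v]) = nth false t v.
  by rewrite inE (tnth_nth false).
have vS (v : 'I_m.+2) : ordS v = (v.+1 %% m.+2)%N :> nat by [].
have vSS (v : 'I_m.+2) : ordS (ordS v) = (v.+2 %% m.+2)%N :> nat.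
  by rewrite vS -addn1 modnDml addn1.
have eqv (v : 'I_m.+2) :
  locally_restrained (v \in [set v | tnth t v])
   (ordS v \in [set v | tnth t v]) (ordS (ordS v) \in [set v | tnth t v]) =
  locally_restrained (nth false s v) (nth false s v.+1) (nth false s v.+2).
  have vm := ltn_ord v.
  rewrite !tS vSS vS !ts ?(modn_small vm) //; lia.
have ss : size (w ++ [:: a; b]) = m.+2 by rewrite size_cat sw addn2.
apply/forallP/restrained_pathP => [H k|H v].
  by rewrite ss => km; have := H (Ordinal km); rewrite eqv.
by rewrite eqv; apply: H; rewrite ss.
Qed.

(** * Subsets as binary words *)

Lemma card_set_tuple (n : nat) (w : n.-tuple bool) :
  #|[set v | tnth w v]| = count id w.
Proof.
rewrite cardsE cardE size_filter -[in RHS](map_tnth_enum w) count_map.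
by rewrite enumT; apply: eq_count.
Qed.

Section WordSums.
Variable V : nmodType.

Lemma big_set_tuple (n : nat) (F : {set 'I_n} -> V) :
  \sum_S F S = \sum_(w : n.-tuple bool) F [set v | tnth w v].
Proof.
apply: (reindex (fun w : n.-tuple bool => [set v | tnth w v])).
exists (fun S : {set 'I_n} => [tuple v \in S | v < n]) => [w _|S _].
  by apply: eq_from_tnth => v; rewrite tnth_mktuple inE.
by apply/setP => v; rewrite inE tnth_mktuple.
Qed.

Lemma big_tuple_cons (n : nat) (F : n.+1.-tuple bool -> V) :
  \sum_w F w = \sum_c \sum_(w : n.-tuple bool) F [tuple of c :: w].
Proof.
rewrite pair_big /=.
apply: (reindex (fun p : bool * n.-tuple bool => [tuple of p.1 :: p.2])).
exists (fun w => (thead w, [tuple of behead w])) => [[c w] _|w _].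
  by congr (_, _); apply: val_inj.
by rewrite [in RHS](tuple_eta w).
Qed.

End WordSums.

(** * Transfer sums and the weight polynomial of the cycle *)

Section Transfer.
Variables (R : comNzRingType) (y : R).

(** Up to the factor [y ^+ (a0 + b0)], this is the entry at [(a, b)], [(a0, b0)] of the transfer
    matrix to the power [n + 2]: only the letters of [w] are weighted. *)
Definition path_weight (n : nat) (a b a0 b0 : bool) : R :=
  \sum_(w : n.-tuple bool)
     (restrained_path a b (w ++ [:: a0; b0]))%:R * y ^+ count id w.

Lemma path_weight0 a b a0 b0 :
  path_weight 0 a b a0 b0 = (restrained_path a b [:: a0; b0])%:R.
Proof.
rewrite /path_weight (big_pred1 [tuple]) ?mulr1 // => w.
by rewrite [w]tuple0 /= eqxx.
Qed.

Lemma path_weightS n a b a0 b0 :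
  path_weight n.+1 a b a0 b0 =
  (locally_restrained a b true)%:R * y * path_weight n b true a0 b0 +
  (locally_restrained a b false)%:R * path_weight n b false a0 b0.
Proof.
rewrite /path_weight big_tuple_cons big_bool /= !big_distrr /=.
by congr (_ + _); apply: eq_bigr => w _ /=; rewrite -mulnb natrM ?exprD; ring.
Qed.

(* [1 - x y - x^3 y] is the reversed characteristic polynomial of the transfer
   matrix, so this is Cayley-Hamilton. *)
Lemma path_weight_rec n a b a0 b0 :
  path_weight n.+4 a b a0 b0 =
  y * path_weight n.+3 a b a0 b0 + y * path_weight n.+1 a b a0 b0.
Proof.
by case: a; case: b; rewrite !path_weightS /locally_restrained /=; ring.
Qed.

Definition cycle_weight (n : nat) : R :=
  \sum_(S : {set 'I_n} | restrained_dominating (@cycle_adj n) S) y ^+ #|S|.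

(** The trace formula: the final pair equals the initial one, and [y ^+ (a + b)] restores the weight
    of the two letters that [path_weight] leaves out. *)
Lemma cycle_weightE (m : nat) : (0 < m)%N ->
  cycle_weight m.+2 =
  y ^+ 2 * path_weight m true true true true +
  y * path_weight m true false true false +
  y * path_weight m false true false true +
  path_weight m false false false false.
Proof.
move=> m0; rewrite /cycle_weight big_mkcond big_set_tuple.
rewrite !big_tuple_cons big_bool /= !big_tuple_cons !big_bool /=.
have step a b : \sum_(w : m.-tuple bool)
    (if restrained_dominating (@cycle_adj m.+2)
          [set v | tnth [tuple of a :: [tuple of b :: w]] v]
     then y ^+ #|[set v | tnth [tuple of a :: [tuple of b :: w]] v]| else 0) =
    y ^+ (a + b) * path_weight m a b a b.
  rewrite /path_weight big_distrr; apply: eq_bigr => w _.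
  rewrite card_set_tuple.
  have -> : [tuple of a :: [tuple of b :: w]] = [tuple of [:: a, b & w]].
    exact: val_inj.
  rewrite restrained_dominating_word //= addnA exprD.
  by case: restrained_path; rewrite ?mul1r ?mul0r ?mulr0.
by rewrite !step /= !addrA mul1r.
Qed.

Lemma cycle_weight_rec (m : nat) : (2 < m)%N ->
  cycle_weight m.+3 = y * cycle_weight m.+2 + y * cycle_weight m.
Proof.
case: m => [|[|[|m]]] // _; rewrite !cycle_weightE // !path_weight_rec.
by ring.
Qed.

Lemma cycle_weight3 : cycle_weight 3 = y ^+ 3 + 3 * y.
Proof.
by rewrite cycle_weightE // !path_weightS !path_weight0 /locally_restrained /=; ring.
Qed.

Lemma cycle_weight4 : cycle_weight 4 = y ^+ 2 * (4 + y ^+ 2).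
Proof.
by rewrite cycle_weightE // !path_weightS !path_weight0 /locally_restrained /=; ring.
Qed.

Lemma cycle_weight5 : cycle_weight 5 = y ^+ 3 * (5 + y ^+ 2).
Proof.
by rewrite cycle_weightE // !path_weightS !path_weight0 /locally_restrained /=; ring.
Qed.

End Transfer.

Arguments cycle_weight {R}.

(** * Comparison with the rational series *)

Lemma fcoef_cycle_weight (n i : nat) :
  fcoef (cycle_weight (fpsX int) n) i = #|cycle_RDS n i|%:R.
Proof.
rewrite /cycle_weight fcoef_sum -sum1_card natr_sum [RHS]big_mkcond.
rewrite [LHS]big_mkcond; apply: eq_bigr => S _.
by rewrite inE fcoefXn; case: restrained_dominating => //=; case: eqP.
Qed.

Theorem theorem3 (n i : nat) (hn : (4 <= n)%N)
    (hi : (n - 2 * (n %/ 3) <= i <= n)%N) :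
  let x : fps (fps int) := fpsX (fps int) in
  let y : fps (fps int) := fpsC (fpsX int) in
  let f : fps (fps int) :=
    (x ^+ 4 * y ^+ 2
       * (4 + y ^+ 2 + x * y + 3 * x ^+ 2 + x ^+ 2 * y ^+ 2))
      / (1 - x * y - x ^+ 3 * y) in
  (#|cycle_RDS n i|%:R : int) = coefxy f n i.
Proof.
(* It suffices to identify the whole coefficient of [x^n], a series in [y], with [cycle_weight]. *)
move=> x y f; rewrite -fcoef_cycle_weight /coefxy; congr (fcoef _ i).
set Y := fpsX int.
have D_unit : 1 - x * y - x ^+ 3 * y \is a GRing.unit.
  rewrite fps_unitE !fcoefB -[x]expr1 -exprM !fcoefXnM /= !subr0.
  exact: unitr1.
(* Clearing the denominator gives a functional equation, with the numerator sorted by powers of [x]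
   so that [fcoefXnM] reads off coefficients. *)
have fE : f = x ^+ 1 * (y * f) + x ^+ 3 * (y * f) +
    x ^+ 4 * (fpsC (Y ^+ 2 * (4 + Y ^+ 2)) + x ^+ 1 * fpsC (Y ^+ 3)
              + x ^+ 2 * fpsC (Y ^+ 2 * (3 + Y ^+ 2))).
  rewrite !(fpsCD, fpsCM) !fpsC1 -/y.
  have := divrK D_unit (x ^+ 4 * y ^+ 2
       * (4 + y ^+ 2 + x * y + 3 * x ^+ 2 + x ^+ 2 * y ^+ 2)).
  rewrite -/f => fD; move: f fD => {}f fD.
  (* With [f] now opaque, both equations take the form of an expression equal to 0, and the two
     expressions agree as polynomials in [x], [y], [f]. *)
  apply/eqP; rewrite -subr_eq0; apply/eqP.
  move/eqP: fD; rewrite -subr_eq0 => /eqP fD; rewrite -{}fD; ring.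
move: f fE => {D_unit} f fE.
have fn k : fcoef f k =
    (if (k < 1)%N then 0 else Y * fcoef f (k - 1)) +
    (if (k < 3)%N then 0 else Y * fcoef f (k - 3)) +
    (if (k < 4)%N then 0 else
      (if k == 4 then Y ^+ 2 * (4 + Y ^+ 2) else 0) +
      (if k == 5 then Y ^+ 3 else 0) +
      (if k == 6 then Y ^+ 2 * (3 + Y ^+ 2) else 0)).
  rewrite [in LHS]fE !fcoefD !fcoefXnM !fcoefD !fcoefXnM !fcoefCM /=.
  by case: k => [|[|[|[|[|[|[|k]]]]]]].
have f_lt4 k : (k < 4)%N -> fcoef f k = 0.
  elim/ltn_ind: k => -[|[|[|[|k]]]] // IHk _;
    by rewrite fn /= ?IHk // ?mulr0 ?addr0.
have f4 : fcoef f 4 = cycle_weight Y 4.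
  by rewrite fn /= !f_lt4 // cycle_weight4; ring.
have f5 : fcoef f 5 = cycle_weight Y 5.
  by rewrite fn /= [fcoef f (5 - 1)]f4 f_lt4 // cycle_weight4 cycle_weight5; ring.
(* Both sides agree at 4 and 5; from 6 on they are compared through their recurrences. *)
elim/ltn_ind: n hn {hi} => -[|[|[|[|[|[|n]]]]]] IHn // _.
rewrite cycle_weight_rec // fn /=.
rewrite subn1 (_ : (n.+4.+2 - 3)%N = n.+3) //=.
rewrite -IHn //; case: n IHn => [|n] IHn.
  (* At index 6 the recurrence calls for [Y * cycle_weight Y 3], while [f] has no [x^3] term; the
     numerator term [Y ^+ 2 * (3 + Y ^+ 2)] is exactly this missing product. *)
  by rewrite f_lt4 // cycle_weight3 /=; ring.
by rewrite -IHn //=; [ring | lia].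
Qed.
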